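(* Let $r\ge 1$ and let $K$ be an $r$-dimensional finite simplicial complex on a vertex set $V$ with $|V|=n$. Then $$\lambda_{\max}\bigl(L^{\mathrm{up}}_{r-1}(K)\bigr)\le n .$$ Moreover, equality holds if and only if $\widetilde H_{r-1}(K^c,\mathbb{R})\ne 0$, where $K^c$ is the $r$-dimensional complement of $K$.
   Context: A finite (abstract) simplicial complex is a collection of finite sets closed under inclusion; the empty set is a face of dimension $-1$. An $r$-face is a face of cardinality $r+1$; $S_r(K)$ is the set of $r$-faces of $K$; the dimension of $K$ is the maximum dimension of its faces. Chain groups and boundary: choose an orientation (an ordering of the vertices up to even permutation) for each face, written $[F]$. $C_r(K,\mathbb{R})$ is the real vector space with basis $B_r(K)=\{[F]:F\in S_r(K)\}$, with $C_{-1}(K,\mathbb{R})=\mathbb{R}$ (augmented chain complex). The boundary map is $\partial_r[v_0,\ldots,v_r]=\sum_{j=0}^r(-1)^j[v_0,\ldots,\widehat{v_j},\ldots,v_r]$ for $r\ge 1$, and $\partial_0(\sum_v a_v v)=\sum_v a_v$. The reduced homology is $\widetilde H_r(K,\mathbb{R})=\ker\partial_r/\operatorname{im}\partial_{r+1}$. Laplacian: $C_r(K,\mathbb{R})$ carries the inner product making $B_r(K)$ orthonormal, and $\partial_r^*$ is the adjoint of $\partial_r$. The combinatorial $(r-1)$-up Laplacian is $L^{\mathrm{up}}_{r-1}(K)=\partial_r\partial_r^*$ acting on $C_{r-1}(K,\mathbb{R})$; $\lambda_{\max}$ denotes its largest eigenvalue. Complement: for an $r$-dimensional complex $K$ on vertex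 set $V$, the $r$-dimensional complement $K^c$ is the complex $$K^c=\Delta_V^{(r-1)}\cup\{F\subseteq V: |F|=r+1,\ F\notin S_r(K)\},$$ where $\Delta_V^{(r-1)}$ is the collection of all subsets of $V$ of cardinality at most $r$ (the complete $(r-1)$-skeleton on $V$). *)

(* Defs.v *)
From HB Require Import structures.
From mathcomp Require Import all_boot all_order all_algebra all_fingroup.
From mathcomp Require classical_sets.
From mathcomp Require Import reals polyrcf complex.

Set Implicit Arguments.
Unset Strict Implicit.
Unset Printing Implicit Defensive.

Import Order.TTheory GRing.Theory Num.Theory.
Local Open Scope ring_scope.

(* The ground set V is the finite type itself, a complex on V being a family
   of subsets of V. As in the usual definition, the empty set is a face of
   every nonempty complex; singletons are not required to be faces. *)
Definition simplicial_complex (V : finType) (K : {set {set V}}) : Prop :=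
  forall F G : {set V}, F \in K -> G \subset F -> G \in K.

(* Faces are indexed by their cardinality, so that dimension -1 is available:
   [faces K k] is $S_{k-1}(K)$. *)
Definition faces (V : finType) (K : {set {set V}}) (k : nat) : {set {set V}} :=
  [set F in K | #|F| == k].

Definition has_dim (V : finType) (K : {set {set V}}) (r : nat) : Prop :=
  (exists2 F, F \in K & #|F| = r.+1) /\ (forall F, F \in K -> (#|F| <= r.+1)%N).

Definition complement (V : finType) (r : nat) (K : {set {set V}}) :
    {set {set V}} :=
  [set F : {set V} | (#|F| <= r)%N]
    :|: [set F : {set V} | (#|F| == r.+1) && (F \notin faces K r.+1)].

Lemma complement_complex (V : finType) (r : nat) (K : {set {set V}}) :
  simplicial_complex (complement r K).
Proof.
move=> F G; rewrite !inE => FK sGF.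
case/orP: FK => [leFr|/andP[/eqP cF FK]].
  by rewrite (leq_trans (subset_leq_card sGF) leFr).
have [//|ltrG] := leqP #|G| r.
have -> : G = F by apply/eqP; rewrite eqEcard sGF cF.
by rewrite cF eqxx /= ?cF ?eqxx in FK *.
Qed.

(* An orientation of a face is an ordering of its vertices up to even
   permutations; it is given here by a representative ordering. *)
Record orientation (V : finType) := Orientation {
  ordering :> {set V} -> seq V;
  orderingP : forall F : {set V}, perm_eq (ordering F) (enum F) }.

(* The sign of the permutation rearranging the list s of distinct vertices
   into t, and 0 when t is not a rearrangement of s. Such a permutation is
   unique since it is required to fix the vertices outside s. *)
Definition order_sign (R : pzRingType) (V : finType) (s t : seq V) : R :=
  if [pick p : {perm V} | perm_on [set x in s] p && (map p s == t)] is Some p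
  then (-1) ^+ p else 0.

Notation face K k := {F : {set _} | F \in faces K k}.

(* [chain R K k] is $C_{k-1}(K, R)$, the function c standing for
   $\sum_F c(F) [F]$. *)
Notation chain R K k := {ffun face K k -> R^o}.

Section Inner.
Variables (R : realFieldType).

Definition inner (I : finType) (c d : {ffun I -> R^o}) : R :=
  \sum_i c i * d i.

Definition basis_chain (I : finType) (i : I) : {ffun I -> R^o} :=
  [ffun j => (j == i)%:R].

Definition adjoint_fun (I J : finType)
    (f : 'Hom({ffun I -> R^o}, {ffun J -> R^o})) (d : {ffun J -> R^o}) :
    {ffun I -> R^o} :=
  [ffun i => inner (f (basis_chain i)) d].

Definition adjoint (I J : finType)
    (f : 'Hom({ffun I -> R^o}, {ffun J -> R^o})) :
    'Hom({ffun J -> R^o}, {ffun I -> R^o}) :=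
  linfun (adjoint_fun f).

Fact adjoint_fun_linear (I J : finType)
    (f : 'Hom({ffun I -> R^o}, {ffun J -> R^o})) :
  linear (adjoint_fun f).
Proof.
move=> a c d; apply/ffunP => i; rewrite !ffunE /inner scaler_sumr -big_split.
by apply: eq_bigr => j _; rewrite !ffunE /= mulrDr mulrCA.
Qed.

HB.instance Definition _ (I J : finType)
    (f : 'Hom({ffun I -> R^o}, {ffun J -> R^o})) :=
  GRing.isLinear.Build R {ffun J -> R^o} {ffun I -> R^o} _ (adjoint_fun f)
    (adjoint_fun_linear f).

Lemma chain_sum_basis (I : finType) (c : {ffun I -> R^o}) :
  c = \sum_i (c i : R) *: basis_chain i.
Proof.
apply/ffunP => j; rewrite sum_ffunE (bigD1 j) //= !ffunE eqxx /=.
rewrite [c j *: _]mulr1 big1 ?addr0 // => i /negPf ij.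
by rewrite !ffunE eq_sym ij scaler0.
Qed.

Lemma innerC (I : finType) (c d : {ffun I -> R^o}) : inner c d = inner d c.
Proof. by apply: eq_bigr => i _; rewrite mulrC. Qed.

Lemma adjointP (I J : finType)
    (f : 'Hom({ffun I -> R^o}, {ffun J -> R^o})) c d :
  inner (f c) d = inner c (adjoint f d).
Proof.
rewrite lfunE /= {1}(chain_sum_basis c) linear_sum /inner.
under eq_bigr => j _ do rewrite sum_ffunE mulr_suml.
rewrite exchange_big; apply: eq_bigr => i _ /=; rewrite ffunE mulr_sumr.
by apply: eq_bigr => j _; rewrite linearZ !ffunE /= mulrA.
Qed.

End Inner.

Section Boundary.
Variables (R : realFieldType) (V : finType) (o : orientation V).
Variable K : {set {set V}}.

(* The chain $[v_0, ..., v_{k-1}]$ for an arbitrary list of distinct vertices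
   forming a face: plus or minus a basis element. *)
Definition osimplex (k : nat) (s : seq V) : chain R K k :=
  [ffun F => order_sign R s (o (val F))].

Definition delete (j : nat) (s : seq V) : seq V := take j s ++ drop j.+1 s.

Definition boundary_fun (k : nat) (c : chain R K k.+1) : chain R K k :=
  \sum_F (c F : R) *:
    \sum_(j < k.+1) (-1 : R) ^+ j *: osimplex k (delete j (o (val F))).

(* [boundary k] is $\partial_k : C_k \to C_{k-1}$. For k = 0 it is the
   augmentation, the only face of cardinality 0 being the empty set. *)
Definition boundary (k : nat) : 'Hom(chain R K k.+1, chain R K k) :=
  linfun (@boundary_fun k).

Fact boundary_fun_linear k : linear (@boundary_fun k).
Proof.
move=> a c d; rewrite /boundary_fun scaler_sumr -big_split /=.
by apply: eq_bigr => F _; rewrite !ffunE scalerDl scalerA.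
Qed.

HB.instance Definition _ k :=
  GRing.isLinear.Build R (chain R K k.+1) (chain R K k) _ (@boundary_fun k)
    (@boundary_fun_linear k).

(* [up_laplacian d] is $L^{up}_d = \partial_{d+1} \partial_{d+1}^*$. *)
Definition up_laplacian (d : nat) : 'End(chain R K d.+1) :=
  (boundary d.+1 \o adjoint (boundary d.+1))%VF.

Definition cycles (d : nat) : {vspace chain R K d.+1} := lker (boundary d).

Definition bounding (d : nat) : {pred subvs_of (cycles d)} :=
  fun z => vsval z \in limg (boundary d.+1).

Fact bounding_zmod_closed d : zmod_closed (@bounding d).
Proof.
split=> [|x y xB yB]; first exact: mem0v.
exact: (@memvB _ _ (limg (boundary d.+1)) (vsval x) (vsval y) xB yB).
Qed.

HB.instance Definition _ d :=
  GRing.isZmodClosed.Build (subvs_of (cycles d)) (@bounding d)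
    (bounding_zmod_closed d).

(* [homology d] is the reduced homology $\ker \partial_d / im \partial_{d+1}$,
   as an additive group. *)
Definition homology (d : nat) : zmodType :=
  @Quotient.quot (subvs_of (cycles d)) (@bounding d).

End Boundary.

Definition is_largest_eigenvalue (R : realType) (U : vectType R) (f : 'End(U))
    (l : R) : Prop :=
  passmx.leigenvalue f l /\ forall m : R, passmx.leigenvalue f m -> m <= l.

(* The default value 0 is never used for [up_laplacian]; see
   [lambda_max_up_laplacianP] below. *)
Definition lambda_max (R : realType) (U : vectType R) (f : 'End(U)) : R :=
  classical_sets.xget 0 (is_largest_eigenvalue f).

Lemma leigenvalueP (R : fieldType) (U : vectType R) (f : 'End(U)) (a : R) :
  reflect (exists2 v, f v = a *: v & v != 0) (passmx.leigenvalue f a).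
Proof.
have kerE v : (v \in passmx.leigenspace f a) = (f v == a *: v).
  by rewrite memv_ker lfun_simp /= !lfun_simp subr_eq0.
apply: (iffP idP) => [nz|[v fv nz]].
  exists (vpick (passmx.leigenspace f a)); last by rewrite vpick0.
  by apply/eqP; rewrite -kerE memv_pick.
apply: contraNneq nz => E0; have := kerE v.
by rewrite E0 memv0 fv eqxx => ->.
Qed.

Lemma symmetric_eigenvalue (R : rcfType) (n : nat) (A : 'M[R]_n) :
  (0 < n)%N -> A^T = A -> exists a, eigenvalue A a.
Proof.
move=> n_gt0 symA.
have [c] := @eigenvalue_closed R[i] n (map_mx (real_complex R) A) n_gt0.
move=> /eigenvalueP[v vA v_neq0].
pose x := map_mx (@complex.Re R) v; pose y := map_mx (@complex.Im R) v.
have ReD : {morph @complex.Re R : u w / u + w} by case=> ? ? [].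
have ImD : {morph @complex.Im R : u w / u + w} by case=> ? ? [].
have xA : x *m A = complex.Re c *: x - complex.Im c *: y.
  apply/rowP => j; have /rowP/(_ j)/(congr1 (@complex.Re R)) := vA.
  rewrite !mxE (big_morph _ ReD (erefl _)).
  under eq_bigr => i _.
    rewrite !mxE (_ : complex.Re _ = x 0 i * A i j); last first.
      by rewrite mxE; case: (v 0 i) => p q /=; rewrite mulr0 subr0.
    over.
  move=> ->; by case: (c) => ? ?; case: (v 0 j).
have yA : y *m A = complex.Im c *: x + complex.Re c *: y.
  apply/rowP => j; have /rowP/(_ j)/(congr1 (@complex.Im R)) := vA.
  rewrite !mxE (big_morph _ ImD (erefl _)).
  under eq_bigr => i _.
    rewrite !mxE (_ : complex.Im _ = y 0 i * A i j); last first.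
      by rewrite mxE; case: (v 0 i) => p q /=; rewrite mulr0 add0r.
    over.
  by move=> ->; case: (c) => ? ?; case: (v 0 j) => ? ? /=; rewrite addrC.
have dotC (u w : 'rV[R]_n) : (u *m w^T) 0 0 = (w *m u^T) 0 0.
  by rewrite -[u *m _]trmxK trmx_mul trmxK mxE.
have dot_ge0 (u : 'rV[R]_n) : 0 <= (u *m u^T) 0 0.
  by rewrite mxE; apply: sumr_ge0 => i _; rewrite mxE -expr2 sqr_ge0.
have dot_eq0 (u : 'rV[R]_n) : ((u *m u^T) 0 0 == 0) = (u == 0).
  apply/eqP/eqP => [|->]; last by rewrite mul0mx mxE.
  rewrite mxE => /eqP; rewrite psumr_eq0; last first.
    by move=> i _; rewrite mxE -expr2 sqr_ge0.
  move=> /allP u0; apply/rowP => i; rewrite [RHS]mxE.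
  by have := u0 i (mem_index_enum i); rewrite mxE mulf_eq0 orbb => /eqP.
have dotE a b (u w t : 'rV[R]_n) : ((a *: u + b *: w) *m t^T) 0 0 =
    a * (u *m t^T) 0 0 + b * (w *m t^T) 0 0.
  by rewrite mulmxDl -!scalemxAl mxE !(mxE scalemx_key).
have xy_neq0 : (x != 0) || (y != 0).
  rewrite -negb_and; apply: contraNN v_neq0 => /andP[/eqP x0 /eqP y0].
  apply/eqP/rowP => i; move/rowP/(_ i): x0; move/rowP/(_ i): y0.
  by rewrite !mxE; case: (v 0 i) => p q /= -> ->.
have Im0 : complex.Im c = 0.
  have : (x *m A *m y^T) 0 0 = (y *m A *m x^T) 0 0.
    by rewrite dotC trmx_mul symA mulmxA.
  rewrite xA yA -scaleNr !dotE (dotC y x) => /eqP.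
  rewrite addrC -subr_eq0 opprD addrACA subrr addr0 mulNr -opprD oppr_eq0.
  rewrite -mulrDr mulf_eq0 => /orP[/eqP //|].
  rewrite paddr_eq0 ?dot_ge0 // !dot_eq0 => /andP[x0 y0].
  by rewrite x0 y0 in xy_neq0.
exists (complex.Re c); apply/eigenvalueP.
move: xA yA; rewrite Im0 !scale0r subr0 add0r => xA yA.
by case/orP: xy_neq0 => nz; [exists x | exists y].
Qed.

Lemma selfadjoint_eigenvalue (R : rcfType) (I : finType)
    (f : 'End({ffun I -> R^o})) :
  (0 < #|I|)%N -> (forall c d, inner (f c) d = inner c (f d)) ->
  exists a, passmx.leigenvalue f a.
Proof.
move=> I_gt0 fS.
have innerb i d : inner (basis_chain R i) d = d i.
  rewrite /inner (bigD1 i) //= ffunE eqxx mul1r big1 ?addr0 // => j /negPf ij.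
  by rewrite ffunE ij mul0r.
pose A := \matrix_(i < #|I|, j < #|I|)
  (f (basis_chain R (enum_val i)) (enum_val j) : R).
have [|a /eigenvalueP[v vA v_neq0]] := symmetric_eigenvalue (A := A) I_gt0.
  by apply/matrixP => i j; rewrite !mxE -innerb -fS innerC innerb.
exists a; apply/leigenvalueP.
pose c : {ffun I -> R^o} := [ffun i => v 0 (enum_rank i)].
exists c; last first.
  apply: contraNneq v_neq0 => c0; apply/eqP/rowP => i.
  by move/ffunP/(_ (enum_val i)): c0; rewrite !ffunE enum_valK mxE.
apply/ffunP => j; rewrite [in LHS](chain_sum_basis c) linear_sum sum_ffunE.
have -> : (a *: c) j = a * v 0 (enum_rank j) by rewrite !ffunE.
have /rowP/(_ (enum_rank j)) := vA; rewrite !mxE => <-.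
rewrite (reindex _ (onW_bij _ (@enum_val_bij I))) /=.
by apply: eq_bigr => i _; rewrite linearZ !ffunE enum_valK mxE enum_rankK.
Qed.

Lemma selfadjoint_largest_eigenvalue (R : realType) (I : finType)
    (f : 'End({ffun I -> R^o})) :
  (0 < #|I|)%N -> (forall c d, inner (f c) d = inner c (f d)) ->
  exists l, is_largest_eigenvalue f l.
Proof.
move=> I_gt0 /(selfadjoint_eigenvalue I_gt0)[a fa].
pose e := vbasis {: {ffun I -> R^o}}.
have e_basis : basis_of {: {ffun I -> R^o}} e := vbasisP _.
pose p := char_poly (passmx.mxof e e f).
have fE b : passmx.leigenvalue f b = (b \in rootsR p).
  have := roots_on_rootsR (monic_neq0 (char_poly_monic (passmx.mxof e e f))).
  move=> /(_ b); rewrite in_itv /= => <-; rewrite -eigenvalue_root_char.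
  by rewrite /passmx.leigenvalue (passmx.leigenspaceE e_basis) passmx.vsof_eq0.
have maxP (s : seq R) :
    a \in s -> exists2 l, l \in s & {in s, forall m, m <= l}.
  elim: s a {fa} => // b [_ a _|b' s IHs a _].
    by exists b; rewrite ?mem_head // => m; rewrite inE => /eqP ->.
  have [l ls lmax] := IHs b' (mem_head _ _).
  have [ble|lb] := leP b l; [exists l | exists b]; rewrite ?mem_head //.
  - by rewrite in_cons ls orbT.
  - by move=> m; rewrite in_cons => /orP[/eqP -> //|/lmax].
  - move=> m; rewrite in_cons => /orP[/eqP -> //|/lmax ml].
    exact: le_trans ml (ltW lb).
have [|l lp lmax] := maxP (rootsR p); first by rewrite -fE.
by exists l; split=> [|m]; rewrite fE // => /lmax.
Qed.

Lemma lambda_max_up_laplacianP (R : realType) (V : finType)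
    (o : orientation V) (K : {set {set V}}) (r : nat) :
  simplicial_complex K -> has_dim K r.+1 ->
  is_largest_eigenvalue (up_laplacian R o K r)
    (lambda_max (up_laplacian R o K r)).
Proof.
move=> cK [[F FK cF] _].
have [v vF] : exists v, v \in F by apply/card_gt0P; rewrite cF.
have GK : F :\ v \in faces K r.+1.
  have /eqP := cardsD1 v F; rewrite vF cF eqSS => /eqP cFv.
  by rewrite inE (cK F) ?subsetDl // -cFv eqxx.
have [||l lP] := @selfadjoint_largest_eigenvalue R _ (up_laplacian R o K r).
- by apply/card_gt0P; exists (exist (fun G => G \in faces K r.+1) _ GK).
- by move=> c d; rewrite !comp_lfunE adjointP [RHS]innerC [RHS]adjointP innerC.
exact: classical_sets.xgetI lP.
Qed.

(* Main.v *)
Require Import Defs.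
From mathcomp Require Import all_boot all_order all_algebra reals.
From mathcomp Require Import all_fingroup zify.

(** Write d and d* for the boundary of the full simplex on V and its adjoint.
    On all chains d d* + d* d = n, where n = #|V|: d is the sum over the
    vertices v of the operator that removes v, d* the sum of the operators
    that insert v, and these satisfy the canonical anticommutation relations
    ([down_up_anticomm]).

    A chain c on the r-sets, that is in degree r - 1, has d* c supported on the
    (r+1)-sets, and those are shared out between K and its complement K^c.
    Taking inner products with c in the identity above therefore gives, for c
    supported on the faces of K ([rayleigh_defect]),
<<
      <L c, c> + |d* c restricted to K^c|^2 + |d c|^2 = n |c|^2
>>
    so every eigenvalue of L is at most n, and n is attained by c exactly when
    d c = 0 and d* c vanishes on the r-faces of K^c. Since K^c contains all
    r-sets, this says that c is a harmonic chain of K^c in degree r - 1. By the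
    Hodge decomposition ([hodge_split], [homology_neq0P]) nonzero harmonic
    chains exist exactly when the homology does not vanish. In the direction
    from K^c to K ([harmonic_eigenvector]) a harmonic chain lives a priori on
    all r-sets, but n c = d d* c is then a boundary of r-faces of K, so c is
    supported on K because n > 0.

    To work with d and d* on plain functions {set V} -> R, free of orientations
    and of the complex, a chain is multiplied by the signs (-1)^inv(F), where
    inv(F) is the number of inversions of the chosen ordering of F relative to
    one fixed order of V ([twist], [extend]). This turns the boundary of every
    complex and every orientation into the same operator [down]
    ([extend_boundary]); [order_signE] is the comparison of signs behind it. *)

Set Implicit Arguments.
Unset Strict Implicit.
Unset Printing Implicit Defensive.

Import Order.TTheory GRing.Theory Num.Theory.
Local Open Scope ring_scope.

(** * Inversions and the sign of a rearrangement *)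

(** A fixed linear order on V, against which all orderings are compared. *)
Definition ltV (V : finType) : rel V := [rel u v | enum_rank u < enum_rank v]%N.

Fixpoint inversions (V : finType) (s : seq V) : nat :=
  if s is x :: s' then count (fun y => ltV y x) s' + inversions s' else 0.

Definition cross (V : finType) (s t : seq V) : nat :=
  \sum_(x <- s) count (fun y => ltV y x) t.

Section Parity.
Variable V : finType.
Implicit Types (s t : seq V) (x y v : V).

Lemma ltV_asym x y : x != y -> ltV x y = ~~ ltV y x.
Proof.
by move=> xy; rewrite /ltV /= -leqNgt ltn_neqAle val_eqE (inj_eq enum_rank_inj) xy.
Qed.

Lemma inversions_cat s t :
  inversions (s ++ t) = (inversions s + inversions t + cross s t)%N.
Proof.
rewrite /cross; elim: s => [|x s IHs] /=; first by rewrite big_nil addn0.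
rewrite IHs count_cat big_cons -!addnA; congr addn.
by rewrite addnCA; congr addn; rewrite addnCA.
Qed.

Lemma perm_cross s s' t t' :
  perm_eq s s' -> perm_eq t t' -> cross s t = cross s' t'.
Proof.
move=> ss' tt'; rewrite /cross (perm_big _ ss'); apply: eq_bigr => x _.
by move/seq.permP: tt' => ->.
Qed.

(** Besides the pair {x, y} itself, each element of s lying between x and y in
    the order of V contributes two pairs whose status changes, and the other
    elements none. *)
Lemma odd_inversions_swap x y s : x != y -> x \notin s -> y \notin s ->
  odd (inversions (y :: s ++ [:: x])) = ~~ odd (inversions (x :: s ++ [:: y])).
Proof.
move=> xy xs ys.
have countC v : v \notin s ->
    odd (count (fun u => ltV u v) s) = odd (size s) (+) odd (count (ltV v) s).
  move=> vs; rewrite -(count_predC (ltV v)) oddD addbC addKb.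
  by congr odd; apply: eq_in_count => u us /=; apply: ltV_asym; apply: contraNneq vs => <-.
rewrite /= !count_cat !inversions_cat /cross /= !oddD.
have cr v : \sum_(x0 <- s) (ltV v x0 + 0)%N = count (ltV v) s.
  by rewrite -sumn_count sumnE big_map; apply: eq_bigr => u _; rewrite addn0.
rewrite !cr !countC // (ltV_asym xy).
case: (odd (size s)); case: (odd (count _ _)); case: (odd (inversions s));
  by case: (odd (count _ _)); case: (ltV y x).
Qed.

Lemma odd_inversions_tperm_cat x y a b c :
  uniq (a ++ x :: b ++ y :: c) ->
  odd (inversions (map (tperm x y) (a ++ x :: b ++ y :: c))) =
  ~~ odd (inversions (a ++ x :: b ++ y :: c)).
Proof.
have mid u v : a ++ u :: b ++ v :: c = a ++ (u :: b ++ [:: v]) ++ c.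
  by rewrite /= -catA.
rewrite map_cat /= map_cat /= tpermL tpermR => uw.
have : uniq [:: x, y & a ++ b ++ c].
  rewrite (perm_uniq (_ : perm_eq _ (a ++ x :: b ++ y :: c))) //.
  apply/seq.permP => q; rewrite /= !count_cat /= !count_cat /=.
  by rewrite [RHS]addnCA; congr addn; rewrite !(addnCA _ (q y)).
case/and3P; rewrite !inE !mem_cat !negb_or => /and4P[xy xa xb xc].
case/and3P=> ya yb yc _.
have fixE t : x \notin t -> y \notin t -> map (tperm x y) t = t.
  move=> xt yt; rewrite -[RHS]map_id; apply/eq_in_map => u ut.
  by rewrite tpermD //; [apply: contraNneq xt | apply: contraNneq yt] => ->.
rewrite !fixE // !mid.
have pxy : perm_eq (y :: b ++ [:: x]) (x :: b ++ [:: y]).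
  by apply/seq.permP => q; rewrite /= !count_cat /= !addn0 addnC (addnC (count q b)) -addnA.
have := odd_inversions_swap xy xb yb.
move: (y :: b ++ [:: x]) (x :: b ++ [:: y]) pxy => yx xy' pxy oddN.
rewrite !(inversions_cat a) !(inversions_cat _ c) !oddD oddN.
have pxyc := pxy; rewrite -(perm_cat2r c) in pxyc.
rewrite (perm_cross (perm_refl a) pxyc) (perm_cross pxy (perm_refl c)).
by rewrite !addNb !addbN ?addNb.
Qed.

Lemma odd_inversions_tperm x y s : uniq s -> x \in s -> y \in s -> x != y ->
  odd (inversions (map (tperm x y) s)) = ~~ odd (inversions s).
Proof.
move=> us xs ys; case/splitPr: xs us ys => a b us.
rewrite mem_cat inE => /orP[ya|/orP[/eqP->|yb]]; last 2 first.
- by rewrite eqxx.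
- case/splitPr: yb us => b1 c us _; exact: odd_inversions_tperm_cat.
case/splitPr: ya us => a1 b1; rewrite -catA cat_cons tpermC => us _.
exact: odd_inversions_tperm_cat.
Qed.

(** Every permutation is a product of transpositions; requiring s to list all of
    V ensures that each of these transpositions moves entries of s. *)
Lemma odd_inversions_perm (p : {perm V}) s : uniq s -> (forall v, v \in s) ->
  odd (inversions (map p s)) = odd_perm p (+) odd (inversions s).
Proof.
case: (prod_tpermP p) => ts ->; elim: ts s => [|[x y] ts IHts] /= s dts us sV.
  rewrite big_nil odd_perm1; congr (odd (inversions _)).
  by rewrite -[RHS]map_id; apply: eq_map => v; rewrite perm1.
case/andP: dts => xy dts; rewrite big_cons /= in xy *.
have -> : map (tperm x y * \prod_(t <- ts) tperm t.1 t.2)%g s =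
    map (\prod_(t <- ts) tperm t.1 t.2)%g (map (tperm x y) s).
  by rewrite -map_comp; apply: eq_map => v; rewrite permM.
rewrite IHts ?map_inj_uniq //; last 2 first.
- exact: perm_inj.
- by move=> v; rewrite -(tpermK x y v) map_f.
by rewrite odd_inversions_tperm // odd_mul_tperm (xy : x != y) addbN addNb.
Qed.

(** Appending the elements of V outside s, which p fixes, reduces this to lists
    of all of V: the inversions between the two parts only depend on the sets
    of their entries. *)
Lemma odd_inversions_perm_on (p : {perm V}) s :
    uniq s -> perm_on [set x in s] p ->
  odd (inversions (map p s)) = odd_perm p (+) odd (inversions s).
Proof.
move=> us ps; pose w := filter [predC s] (enum V).
have pw : map p w = w.
  rewrite -[RHS]map_id; apply/eq_in_map => v; rewrite mem_filter /= => /andP[vs _].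
  by rewrite (out_perm ps) // inE.
have mE : perm_eq (map p s) s.
  apply: uniq_perm; rewrite ?map_inj_uniq //; first exact: perm_inj.
  move=> v; rewrite -[v in RHS](permKV p) -{1}[v](permKV p) mem_map; last exact: perm_inj.
  by have := perm_closed (p^-1 v)%g ps; rewrite !inE.
have := @odd_inversions_perm p (s ++ w).
rewrite map_cat pw !inversions_cat !oddD (perm_cross mE (perm_refl w)).
rewrite !addbA => sw; do 2![apply: addIb]; apply: sw.
  rewrite cat_uniq us filter_uniq ?enum_uniq // andbT /=.
  by apply/hasPn => v; rewrite mem_filter => /andP[].
by move=> v; rewrite mem_cat mem_filter /= mem_enum andbT orbN.
Qed.

(** The map sending the i-th entry of s to the i-th entry of t, and fixing all
    other vertices. *)
Lemma perm_eq_map_perm s t : uniq s -> perm_eq s t ->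
  exists2 p : {perm V}, perm_on [set x in s] p & map p s = t.
Proof.
move=> us st; have ut : uniq t by rewrite -(perm_uniq st).
have szt := perm_size st.
pose f x := if x \in s then nth x t (index x s) else x.
have ft x : x \in s -> f x \in s.
  move=> xs; rewrite /f xs (perm_mem st) mem_nth // -szt index_mem //.
have injf : injective f.
  move=> x y; have [[xs|xs] [ys|ys]] := (boolP (x \in s), boolP (y \in s)).
  - rewrite /f xs ys (set_nth_default y) -?szt ?index_mem // => /eqP.
    rewrite nth_uniq -?szt ?index_mem // => /eqP eqi.
    by rewrite -(nth_index x xs) eqi nth_index.
  - by move=> e; have := ft _ xs; rewrite e {1}/f (negPf ys) (negPf ys).
  - by move=> e; have := ft _ ys; rewrite -e {1}/f (negPf xs) (negPf xs).
  - by rewrite /f (negPf xs) (negPf ys).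
exists (perm injf).
  by apply/subsetP => x; rewrite !inE permE /f; case: ifP => //; rewrite eqxx.
case: s us st szt @f ft injf => [|x0 s] us st szt f ft injf.
  by apply/esym/nilP; rewrite /nilp -szt.
apply: (@eq_from_nth _ x0) => [|i]; rewrite size_map // => lti.
rewrite (nth_map x0) // permE /f mem_nth // index_uniq //.
by apply: set_nth_default; rewrite -szt.
Qed.

(** This splits the sign of a rearrangement into a factor for each of the two
    orderings, which is what lets a change of basis remove the orientations. *)
Lemma order_signE (R : pzRingType) s t : uniq s ->
  order_sign R s t = if perm_eq s t
    then (-1) ^+ inversions s * (-1) ^+ inversions t else 0.
Proof.
move=> us; rewrite /order_sign; case: pickP => [p /andP[ps /eqP <-]|none].
  have -> : perm_eq s (map p s).
    apply: uniq_perm; rewrite ?map_inj_uniq //; first exact: perm_inj.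
    move=> v; rewrite -[v in RHS](permKV p) mem_map; last exact: perm_inj.
    by have := perm_closed (p^-1 v)%g ps; rewrite !inE permKV.
  rewrite -exprD -[RHS]signr_odd oddD odd_inversions_perm_on // addbCA addbb.
  by rewrite addbF.
case: ifP => // /(perm_eq_map_perm us)[p ps pt].
by have := none p; rewrite ps pt eqxx.
Qed.
End Parity.

(** * Removing and inserting vertices *)

Section Wedge.
Variables (R : realFieldType) (V : finType).
Implicit Types (x y : {set V} -> R) (F G : {set V}) (u v : V).

Definition below F v : nat := #|[set u in F | ltV u v]|.

(** The Koszul sign for inserting v into F or removing it from F, when the
    vertices are kept in increasing order. *)
Definition vsign F v : R := (-1) ^+ below F v.

(** The boundary of the full simplex on V in all degrees at once, for faces
    oriented by the order of V. *)
Definition down x G : R := \sum_(v | v \notin G) vsign G v * x (v |: G).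

(** The adjoint of [down], see [down_adjoint]. *)
Definition up x F : R := \sum_(v in F) vsign F v * x (F :\ v).

Lemma belowU1 F u v : u \notin F -> below (u |: F) v = (ltV u v + below F v)%N.
Proof.
move=> uF; rewrite /below (cardsD1 u) !inE eqxx /=; congr addn.
apply: eq_card => w; rewrite !inE; case: eqVneq => //= ->.
by rewrite (negPf uF).
Qed.

Lemma belowU1_same F v : below (v |: F) v = below F v.
Proof.
by apply: eq_card => w; rewrite !inE; case: eqVneq => //= ->; rewrite /ltV /= ltnn !andbF.
Qed.

(** Inserting u and v in the two possible orders gives opposite signs, since
    exactly one of u < v and v < u holds. *)
Lemma vsign_swap F u v : v \notin F -> u \notin F -> u != v ->
  vsign F v * vsign (v |: F) u = - (vsign F u * vsign (u |: F) v).
Proof.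
move=> vF uF uv; rewrite /vsign !belowU1 // !exprD (ltV_asym uv).
by case: ltV; rewrite ?mulN1r ?mul1r ?mulrN ?opprK mulrC.
Qed.

Lemma vsign_sqr F v : vsign F v * vsign F v = 1.
Proof. by rewrite -expr2 sqrr_sign. Qed.

(** Inserting v and then removing it gives back G, and likewise removing u and
    then inserting it: altogether every vertex of V contributes x G once. The
    terms that replace u in G by v outside G occur in both products, with
    opposite signs. *)
Lemma down_up_anticomm x G : down (up x) G + up (down x) G = #|V|%:R * x G.
Proof.
have -> : down (up x) G = #|~: G|%:R * x G + \sum_(v | v \notin G) \sum_(u in G)
    vsign G v * (vsign (v |: G) u * x ((v |: G) :\ u)).
  rewrite mulr_natl -sumr_const (eq_bigl (fun v => v \notin G)) => [|v]; last first.
    by rewrite inE.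
  rewrite -big_split /=; apply: eq_bigr => v vG.
  rewrite /up big_setU1 //= mulrDr mulr_sumr; congr +%R.
  by rewrite setU1K // mulrA {2}/vsign belowU1_same vsign_sqr mul1r.
have -> : up (down x) G = #|G|%:R * x G + \sum_(u in G) \sum_(v | v \notin G)
    vsign G u * (vsign (G :\ u) v * x (v |: (G :\ u))).
  rewrite mulr_natl -sumr_const -big_split /=; apply: eq_bigr => u uG.
  rewrite /down (bigD1 u) ?setD11 //= mulrDr; congr +%R.
    rewrite setD1K // mulrA /vsign -{1}(setD1K uG) belowU1_same.
    by rewrite -/(vsign _ _) vsign_sqr mul1r.
  rewrite mulr_sumr; apply: eq_bigl => v; rewrite !inE negb_and negbK.
  by case: eqVneq => [->|_]; rewrite ?uG ?andbT.
(* The diagonal terms give #|V|; the others are cancelled pair by pair. *)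
rewrite addrACA -mulrDl -natrD addnC cardsC [X in _ + X]addrC exchange_big /=.
rewrite -big_split big1 ?addr0 //= => v vG; rewrite -big_split big1 //= => u uG.
have uv : u != v by apply: contraNneq vG => <-.
have -> : (v |: G) :\ u = v |: (G :\ u).
  by apply/setP => w; rewrite !inE; case: eqVneq => //= ->; rewrite (negPf uv).
have uGu : u \notin G :\ u by rewrite setD11.
have vGu : v \notin G :\ u by rewrite !inE negb_and vG orbT.
(* Both signs are computed by inserting u and v into G :\ u. *)
rewrite !mulrA -mulrDl /vsign -(setD1K uG) setUCA !belowU1_same setU1K //.
rewrite !belowU1 // !exprD (ltV_asym uv).
by case: ltV; rewrite ?(mulN1r, mul1r, mulrN, mulNr) [X in X - _]mulrC subrr mul0r.
Qed.

(** Exchanging the order in which the two vertices are added shows that the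
    double sum is its own opposite. *)
Lemma down_down x G : down (down x) G = 0.
Proof.
pose t v u := vsign G v * (vsign (v |: G) u * x (u |: (v |: G))).
have E : down (down x) G = \sum_(v | v \notin G) \sum_(u | u \notin v |: G) t v u.
  by apply: eq_bigr => v _; rewrite mulr_sumr.
suff /eqP : down (down x) G = - down (down x) G.
  by rewrite -addr_eq0 -mulr2n mulrn_eq0 /= => /eqP.
rewrite {1}E (exchange_big_dep (fun u => u \notin G)) /=; last first.
  by move=> v u _; rewrite !inE negb_or => /andP[].
rewrite E -sumrN; apply: eq_bigr => v vG; rewrite -sumrN; apply: eq_big => u.
  by rewrite !inE !negb_or eq_sym vG andbT andbC.
rewrite !inE !negb_or => /and3P[uG vu _].
by rewrite /t !mulrA (vsign_swap uG vG vu) setUCA mulNr.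
Qed.

Lemma down_adjoint x y : \sum_G down x G * y G = \sum_F x F * up y F.
Proof.
under eq_bigr => G _ do rewrite mulr_suml big_mkcond.
rewrite exchange_big /=.
under [RHS]eq_bigr => F _ do rewrite mulr_sumr big_mkcond.
rewrite [RHS]exchange_big /=; apply: eq_bigr => v _; rewrite -!big_mkcond /=.
rewrite (reindex_onto (fun F => F :\ v) (fun G => v |: G)) /=; last first.
  by move=> G; exact: setU1K.
apply: eq_big => F.
  rewrite setD11 /=; apply/eqP/idP => [<-|]; [exact: setU11 | exact: setD1K].
case/andP=> _ /eqP FE; have -> : vsign F v = vsign (F :\ v) v.
  by rewrite -{1}FE /vsign belowU1_same.
by rewrite FE mulrA [x F * _]mulrC.
Qed.

Lemma down_incidence x G :
  down x G = \sum_F x F * \sum_(v in F | G == F :\ v) vsign F v.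
Proof.
under [RHS]eq_bigr => F _ do rewrite mulr_sumr big_mkcond.
rewrite exchange_big /down big_mkcond /=; apply: eq_bigr => v _.
rewrite -big_mkcond /=; case: ifP => [vG|/negbFE vG]; last first.
  by rewrite big_pred0 // => F; case: eqP vG => [->|]; rewrite ?setD11 ?andbF.
rewrite (big_pred1 (v |: G)) => [|F]; last first.
  apply/andP/eqP => [[vF /eqP->]|->]; first by rewrite setD1K.
  by rewrite setU11 setU1K.
by rewrite mulrC /vsign belowU1_same.
Qed.

End Wedge.

(** * Chains of a complex as functions on all vertex sets *)

Section Incidence.
Variables (R : realFieldType) (V : finType).
Implicit Types (F G : {set V}) (s : seq V) (v : V).

(** The inversions that involve v come from the u in a with v < u and the u in b
    with u < v. Adding the vertices below v completes the former to all of a and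
    counts the latter twice. *)
Lemma sign_delete a v b : uniq (a ++ v :: b) ->
  (-1) ^+ size a * (-1) ^+ inversions (a ++ b) =
  (-1) ^+ inversions (a ++ v :: b) * vsign R [set x in a ++ v :: b] v.
Proof.
move=> us; have belowE : below [set x in a ++ v :: b] v =
    (count (fun u => ltV u v) a + count (fun u => ltV u v) b)%N.
  rewrite /below (_ : [set _ in _ | _] =
      [set x in filter (fun u => ltV u v) (a ++ v :: b)]); last first.
    by apply/setP => u; rewrite !inE mem_filter andbC.
  rewrite cardsE (card_uniqP (filter_uniq _ us)) size_filter count_cat /=.
  by rewrite /ltV /= ltnn.
have va : v \notin a.
  by move: us; rewrite cat_uniq /= => /and3P[_ /norP[]].
have sizeE : size a = (count (fun u => ltV u v) a + count (ltV v) a)%N.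
  rewrite -(count_predC (fun u => ltV u v)); congr addn; apply: eq_in_count => u ua.
  by rewrite /= [in RHS]ltV_asym //; apply: contraNneq va => ->.
have crossE : cross a (v :: b) = (count (ltV v) a + cross a b)%N.
  rewrite /cross /= big_split /=; congr addn.
  by rewrite -sumn_count sumnE big_map.
rewrite /vsign belowE -!exprD !inversions_cat crossE /= {1}sizeE.
set n := (X in _ = _ ^+ X); set m := (X in _ ^+ X = _).
have -> : n = (m + (count (fun u => ltV u v) b).*2)%N by rewrite /n /m; lia.
by rewrite exprD -mul2n exprM sqrrN !expr1n mulr1.
Qed.

Definition twist (o : orientation V) F : R := (-1) ^+ inversions (o F).

Lemma twist_sqr o F : twist o F * twist o F = 1.
Proof. by rewrite -expr2 sqrr_sign. Qed.

Lemma mem_ordering (o : orientation V) F : o F =i F.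
Proof. by move=> v; rewrite (perm_mem (orderingP o F)) mem_enum. Qed.

Lemma ordering_uniq (o : orientation V) F : uniq (o F).
Proof. by rewrite (perm_uniq (orderingP o F)) enum_uniq. Qed.

Lemma size_ordering (o : orientation V) F : size (o F) = #|F|.
Proof. by rewrite (perm_size (orderingP o F)) -cardE. Qed.

(** The incidence number of F and G is, up to the twists of the two faces, the
    one for the orientation by the order of V. *)
Lemma incidence (o : orientation V) k F G : #|F| = k ->
  \sum_(j < k) (-1 : R) ^+ j * order_sign R (delete j (o F)) (o G) =
  twist o F * twist o G * \sum_(v in F | G == F :\ v) vsign R F v.
Proof.
have [k0|k_gt0] := posnP k.
  move: k0 => -> /cards0_eq ->; rewrite big_ord0 big1 ?mulr0 // => v.
  by rewrite inE.
move=> cF; have [x0 _] : exists v, v \in F by apply/card_gt0P; rewrite cF.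
rewrite mulr_sumr big_mkcondr.
rewrite -(eq_bigl _ _ (mem_ordering o F)) -big_uniq ?ordering_uniq //=.
rewrite (big_nth x0) size_ordering cF big_mkord; apply: eq_bigr => j _.
have us := ordering_uniq o F.
have ltj : (j < size (o F))%N by rewrite size_ordering cF.
set v := nth x0 (o F) j; set a := take j (o F); set b := drop j.+1 (o F).
have sE : o F = a ++ v :: b by rewrite -drop_nth // cat_take_drop.
have FE : [set x in a ++ v :: b] = F.
  by apply/setP => u; rewrite -sE inE mem_ordering.
have ja : j = size a :> nat by rewrite size_take ltj.
have uab : uniq (a ++ v :: b) by rewrite -sE.
have uv : uniq (v :: a ++ b).
  by rewrite -cat1s uniq_catCA /=.
have memab u : (u \in a ++ b) = (u \in F :\ v).
  rewrite !inE -FE inE !mem_cat inE; case: eqVneq => //= ->.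
  by move: uv; rewrite /= mem_cat => /andP[/negPf].
have -> : delete j (o F) = a ++ b by [].
case/andP: uv => _ uv; rewrite order_signE //.
have -> : perm_eq (a ++ b) (o G) = (G == F :\ v).
  apply/idP/eqP => [/perm_mem abG|GE].
    by apply/setP => u; rewrite -memab abG mem_ordering.
  apply: uniq_perm => // [|u]; first exact: ordering_uniq.
  by rewrite memab mem_ordering GE.
case: ifP => _; last by rewrite !mulr0.
by rewrite mulrA {1}ja (sign_delete uab) FE /twist sE mulrAC.
Qed.

End Incidence.

Section Chains.
Variables (R : realFieldType) (V : finType) (o : orientation V).
Variable K : {set {set V}}.
Implicit Types (F G : {set V}) (x y : {set V} -> R).

(** The function on all vertex sets, zero outside the k-element faces of K, that
    gives the coordinates of c in the basis oriented by the order of V. *)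
Definition extend k (c : chain R K k) F : R :=
  if insub F : option (face K k) is Some f then twist R o F * c f else 0.

Definition restrict k x : chain R K k :=
  [ffun f => twist R o (val f) * x (val f)].

Lemma extend_val k (c : chain R K k) f : extend c (val f) = twist R o (val f) * c f.
Proof. by rewrite /extend valK. Qed.

Lemma extend_out k (c : chain R K k) F : F \notin faces K k -> extend c F = 0.
Proof. by move=> FK; rewrite /extend insubN. Qed.

Lemma twist_extend k (c : chain R K k) f : c f = twist R o (val f) * extend c (val f).
Proof. by rewrite extend_val mulrA twist_sqr mul1r. Qed.

Lemma extend_restrict k x F : F \in faces K k -> extend (restrict k x) F = x F.
Proof.
by move=> FK; rewrite -[F](SubK (face K k) FK) extend_val ffunE mulrA twist_sqr mul1r.
Qed.

Lemma extend_inj k (c d : chain R K k) : extend c =1 extend d -> c = d.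
Proof. by move=> cd; apply/ffunP => f; rewrite !twist_extend cd. Qed.

Lemma extendZ k a (c : chain R K k) F : extend (a *: c) F = a * extend c F.
Proof.
by rewrite /extend; case: insub => [f|]; rewrite ?mulr0 // ffunE [RHS]mulrCA.
Qed.

Lemma extend0 k F : extend (0 : chain R K k) F = 0.
Proof. by rewrite -(scale0r 0) extendZ mul0r. Qed.

(** The change of basis is orthogonal, the twists being signs. *)
Lemma inner_extend k (c d : chain R K k) : inner c d = \sum_F extend c F * extend d F.
Proof.
rewrite (bigID (fun F => F \in faces K k)) /= [X in _ + X]big1 ?addr0; last first.
  by move=> F FK; rewrite extend_out ?mul0r.
rewrite big_sub /inner; apply: eq_bigr => f _.
by rewrite !extend_val mulrACA twist_sqr mul1r.
Qed.

Lemma extend_boundary k (c : chain R K k.+1) G : G \in faces K k ->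
  extend (boundary R o K k c) G = down (extend c) G.
Proof.
move=> GK; rewrite -[G](SubK (face K k) GK); set g := Sub G GK.
rewrite extend_val lfunE /= /boundary_fun sum_ffunE mulr_sumr down_incidence.
rewrite (bigID (fun F => F \in faces K k.+1)) /= [X in _ + X]big1 ?addr0; last first.
  by move=> F FK; rewrite extend_out ?mul0r.
rewrite [RHS]big_sub /=; apply: eq_bigr => f _; rewrite !ffunE.
have cf : #|val f| = k.+1 by have := valP f; rewrite inE => /andP[_ /eqP].
have -> : (\sum_(j < k.+1)
    (-1 : R) ^+ j *: osimplex R o K k (delete j (o (val f)))) g =
    \sum_(j < k.+1) (-1 : R) ^+ j * order_sign R (delete j (o (val f))) (o G).
  by rewrite sum_ffunE; apply: eq_bigr => j _; rewrite !ffunE.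
rewrite (incidence R o G cf) extend_val /= [_ *: _]mulrC.
rewrite (mulrC (twist R o (sval f))) -!mulrA [LHS]mulrA twist_sqr mul1r.
by congr (_ * _); rewrite mulrC.
Qed.

(** The coordinate at F of an adjoint is an inner product with the image of the
    basis chain of F, whose extension is supported on F alone. *)
Lemma extend_adjoint_boundary k (d : chain R K k) F : F \in faces K k.+1 ->
  extend (adjoint (boundary R o K k) d) F = up (extend d) F.
Proof.
move=> FK; rewrite -[F](SubK (face K k.+1) FK); set f := Sub F FK.
have bE g : extend (basis_chain R f) g = if g == val f then twist R o (val f) else 0.
  have [gK|gK] := boolP (g \in faces K k.+1); last first.
    by rewrite extend_out //; case: eqP gK => // -> /negP[]; exact: valP.
  rewrite -[g](SubK (face K k.+1) gK) extend_val ffunE val_eqE.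
  by case: eqP => [->|]; rewrite ?mulr1 ?mulr0.
rewrite extend_val lfunE /= ffunE inner_extend.
transitivity (twist R o (val f) * \sum_G down (extend (basis_chain R f)) G * extend d G).
  congr (_ * _); apply: eq_bigr => G _.
  have [GK|GK] := boolP (G \in faces K k); first by rewrite extend_boundary.
  by rewrite (extend_out d GK) !mulr0.
rewrite down_adjoint (bigD1 (val f)) //= big1 ?addr0 => [|G /negPf Gf].
  by rewrite bE eqxx mulrA twist_sqr mul1r.
by rewrite bE Gf mul0r.
Qed.

(** A complex contains the faces of its faces, so that the boundary in the full
    simplex of a chain of K is again a chain of K. *)
Lemma down_extend_out k (c : chain R K k.+1) G :
  simplicial_complex K -> G \notin faces K k -> down (extend c) G = 0.
Proof.
move=> cK GK; apply: big1 => v vG; rewrite extend_out ?mulr0 //.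
apply: contraNN GK; rewrite !inE cardsU1 vG eqSS => /andP[vGK ->].
by rewrite (cK _ _ vGK) ?subsetUr.
Qed.

End Chains.

(** * Hodge theory for real chains *)

Section Hodge.
Variable R : realFieldType.

Lemma inner_ge0 (I : finType) (c : {ffun I -> R^o}) : 0 <= inner c c.
Proof. by apply: sumr_ge0 => i _; rewrite -expr2 sqr_ge0. Qed.

Lemma inner_eq0 (I : finType) (c : {ffun I -> R^o}) : (inner c c == 0) = (c == 0).
Proof.
apply/eqP/eqP => [/psumr_eq0P c0|->].
  apply/ffunP => i; rewrite ffunE; apply/eqP.
  by rewrite -sqrf_eq0 expr2 c0 // => j _; rewrite -expr2 sqr_ge0.
by apply: big1 => i _; rewrite ffunE mul0r.
Qed.

Lemma adjoint_normal_eq0 (I J : finType)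
    (f : 'Hom({ffun I -> R^o}, {ffun J -> R^o})) d :
  f (adjoint f d) = 0 -> adjoint f d = 0.
Proof.
move=> fd; apply/eqP; rewrite -inner_eq0 -adjointP fd.
by apply/eqP/big1 => i _; rewrite ffunE mul0r.
Qed.

(** The operator A = f f* is self-adjoint, so ker (A A) = ker A, hence by
    dimension im (A A) = im A. Thus A d = A (A u) for some u, and d - A u lies in
    ker A = ker f*. *)
Lemma hodge_split (I J : finType)
    (f : 'Hom({ffun I -> R^o}, {ffun J -> R^o})) d :
  exists y, adjoint f (d - f y) = 0.
Proof.
pose A := (f \o adjoint f)%VF.
have AE u : A u = f (adjoint f u) by rewrite comp_lfunE.
have AAE u : A (A u) = 0 -> A u = 0.
  rewrite {1}AE => /adjoint_normal_eq0 h.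
  apply/eqP; rewrite -inner_eq0 {1}AE adjointP h.
  by apply/eqP/big1 => i _; rewrite ffunE mulr0.
have kerE : lker (A \o A)%VF = lker A.
  apply/vspaceP => u; rewrite !memv_ker comp_lfunE.
  by apply/eqP/eqP => [/AAE|->]; rewrite ?linear0.
have imE : limg (A \o A)%VF = limg A.
  apply/eqP; rewrite eqEdim limg_comp limgS ?subvf //= -limg_comp.
  have := limg_ker_dim (A \o A)%VF fullv; rewrite kerE -(limg_ker_dim A fullv).
  by move/addnI => ->.
have /memv_imgP[u _ Ad] : A d \in limg (A \o A)%VF by rewrite imE memv_img ?memvf.
exists (adjoint f u); apply: adjoint_normal_eq0; rewrite -!AE linearB /=.
by rewrite Ad comp_lfunE subrr.
Qed.

End Hodge.

Section Homology.
Local Open Scope quotient_scope.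
Local Open Scope ring_scope.
Variables (R : realFieldType) (V : finType) (o : orientation V).
Variables (K : {set {set V}}) (cK : simplicial_complex K).

Lemma boundary_boundary k c : boundary R o K k (boundary R o K k.+1 c) = 0.
Proof.
apply: (extend_inj (o := o)) => G; rewrite extend0.
have [GK|GK] := boolP (G \in faces K k); last by rewrite extend_out.
rewrite extend_boundary // -[RHS](down_down (extend o c) G).
apply: eq_bigr => v vG; congr (_ * _).
have [FK|FK] := boolP ((v |: G) \in faces K k.+1); first exact: extend_boundary.
by rewrite extend_out // down_extend_out.
Qed.

(** A harmonic representative of a class is obtained by removing from a cycle
    its component along the boundaries; conversely a harmonic chain is
    orthogonal to all boundaries, so it is one only if it vanishes. *)
Lemma homology_neq0P d :
  (exists h : homology R o K d, h != 0) <->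
  exists c : chain R K d.+1,
    [/\ c != 0, boundary R o K d c = 0 & adjoint (boundary R o K d.+1) c = 0].
Proof.
have piE z : (\pi_(homology R o K d) z == 0) = (vsval z \in limg (boundary R o K d.+1)).
  by rewrite -[0](raddf0 \pi_(homology R o K d)) -Quotient.idealrBE subr0.
split=> [[h h0]|[c [c0 dc ac]]].
  have [z zh] : exists z, h = \pi_(homology R o K d) z.
    by exists (generic_quotient.repr h); rewrite reprK.
  have [y hy] := hodge_split (boundary R o K d.+1) (vsval z).
  exists (vsval z - boundary R o K d.+1 y); split=> //.
    apply: contraNneq h0 => /eqP; rewrite subr_eq0 => /eqP zE.
    by rewrite zh piE zE memv_img ?memvf.
  rewrite linearB /= boundary_boundary subr0.
  by apply/eqP; rewrite -memv_ker subvsP.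
have cZ : c \in cycles R o K d by rewrite memv_ker dc.
exists (\pi_(homology R o K d) (Subvs cZ)); rewrite piE /=; apply/negP => /memv_imgP[y _ cE].
case/eqP: c0; apply/eqP; rewrite -inner_eq0 {1}cE adjointP ac.
by apply/eqP/big1 => i _; rewrite ffunE mulr0.
Qed.
End Homology.

(** * The Laplacian of a complex and the homology of its complement *)

Section Complement.
Variables (R : realFieldType) (V : finType) (o oc : orientation V).
Variables (K : {set {set V}}) (r : nat).
Local Notation Kc := (complement r.+1 K).

Lemma eq_down (x y : {set V} -> R) : x =1 y -> down x =1 down y.
Proof. by move=> xy G; apply: eq_bigr => v _; rewrite xy. Qed.

Lemma eq_up (x y : {set V} -> R) : x =1 y -> up x =1 up y.
Proof. by move=> xy F; apply: eq_bigr => v _; rewrite xy. Qed.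

Lemma up_card (x : {set V} -> R) k (F : {set V}) :
  (forall G : {set V}, #|G| != k -> x G = 0) -> #|F| != k.+1 -> up x F = 0.
Proof.
move=> xk Fk; apply: big1 => v vF; rewrite xk ?mulr0 //.
by move: Fk; rewrite (cardsD1 v) vF.
Qed.

Lemma extend_card L k (c : chain R L k) (F : {set V}) : #|F| != k -> extend o c F = 0.
Proof. by move=> Fk; rewrite extend_out // inE negb_and Fk orbT. Qed.

Lemma faces_complement_low (F : {set V}) : (F \in faces Kc r.+1) = (#|F| == r.+1).
Proof. by rewrite !inE; case: (#|F| =P r.+1) => [->|]; rewrite ?andbF ?leqnn. Qed.

Lemma faces_complement_top (F : {set V}) :
  (F \in faces Kc r.+2) = (#|F| == r.+2) && (F \notin faces K r.+2).
Proof. by rewrite !inE; case: eqP => [->|]; rewrite ?andbF ?ltnn ?andbT. Qed.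

(** The anticommutation relation, paired with x. *)
Lemma energy (x : {set V} -> R) :
  \sum_F up x F ^+ 2 + \sum_F down x F ^+ 2 = #|V|%:R * \sum_F x F ^+ 2.
Proof.
rewrite (eq_bigr (fun F => up x F * up x F)) // -down_adjoint.
rewrite [X in _ + X](eq_bigr (fun F => down x F * down x F)) // [X in _ + X]down_adjoint.
rewrite -big_split mulr_sumr; apply: eq_bigr => F _ /=.
by rewrite [X in X + _]mulrC -mulrDr down_up_anticomm mulrCA.
Qed.

(** In [energy], the sum of squares of [up] over the faces of K with r.+2
    vertices is the Rayleigh form of the Laplacian. The remaining sums are nonnegative and
    measure how far c is from being harmonic on the complement. *)
Lemma rayleigh_defect (c : chain R K r.+1) :
  inner (up_laplacian R o K r c) c
  + (\sum_(F | F \notin faces K r.+2) up (extend o c) F ^+ 2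
     + \sum_F down (extend o c) F ^+ 2) = #|V|%:R * inner c c.
Proof.
rewrite comp_lfunE adjointP (inner_extend o c) -energy addrA; congr (_ + _).
rewrite (inner_extend o) [RHS](bigID (fun F => F \in faces K r.+2)) /=.
congr (_ + _); rewrite (bigID (fun F => F \in faces K r.+2)) /=.
rewrite [X in _ + X]big1 ?addr0 => [|F FK]; last by rewrite extend_out ?mul0r.
by apply: eq_bigr => F FK; rewrite extend_adjoint_boundary.
Qed.

Lemma up_laplacian_eigenvalue_le l :
  passmx.leigenvalue (up_laplacian R o K r) l -> l <= #|V|%:R.
Proof.
case/leigenvalueP => c Lc c0.
have cc : 0 < inner c c by rewrite lt0r inner_eq0 c0 inner_ge0.
rewrite -(ler_pM2r cc) -rayleigh_defect Lc.
have -> : inner (l *: c) c = l * inner c c.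
  by rewrite mulr_sumr; apply: eq_bigr => i _; rewrite ffunE mulrA.
by rewrite lerDl addr_ge0 // sumr_ge0 // => F _; rewrite sqr_ge0.
Qed.

(** At the eigenvalue n both defects of [rayleigh_defect] vanish, so the
    eigenvector, seen as a chain of the complement, is harmonic there. *)
Lemma eigenvector_harmonic :
  passmx.leigenvalue (up_laplacian R o K r) #|V|%:R ->
  exists c : chain R Kc r.+1,
    [/\ c != 0, boundary R oc Kc r c = 0 & adjoint (boundary R oc Kc r.+1) c = 0].
Proof.
case/leigenvalueP => c Lc c0; have := rayleigh_defect c; rewrite Lc.
have -> : inner (#|V|%:R *: c) c = #|V|%:R * inner c c.
  by rewrite mulr_sumr; apply: eq_bigr => i _; rewrite ffunE mulrA.
move/eqP; rewrite -subr_eq0 addrAC subrr add0r paddr_eq0; last 2 first.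
- by rewrite sumr_ge0 // => F _; rewrite sqr_ge0.
- by rewrite sumr_ge0 // => F _; rewrite sqr_ge0.
rewrite !psumr_eq0; try by move=> F _; rewrite sqr_ge0.
case/andP=> /allP upK /allP downK.
have up0 F : F \notin faces K r.+2 -> up (extend o c) F = 0.
  by move=> FK; apply/eqP; rewrite -sqrf_eq0; exact: (implyP (upK F (mem_index_enum F))).
have down0 F : down (extend o c) F = 0.
  by apply/eqP; rewrite -sqrf_eq0; exact: (downK F (mem_index_enum F)).
pose d := restrict oc Kc r.+1 (extend o c).
have dE : extend oc d =1 extend o c.
  move=> F; have [Fr|Fr] := eqVneq #|F| r.+1.
    by rewrite extend_restrict // faces_complement_low Fr.
  by rewrite (extend_card _ Fr) extend_out // faces_complement_low.
exists d; split.
- apply: contraNneq c0 => d0; apply/eqP/(extend_inj (o := o)) => F.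
  by rewrite extend0 -dE d0 extend0.
- apply: (extend_inj (o := oc)) => G; rewrite extend0.
  have [GK|GK] := boolP (G \in faces Kc r); last by rewrite extend_out.
  by rewrite extend_boundary // (eq_down dE).
- apply: (extend_inj (o := oc)) => F; rewrite extend0.
  have [FK|FK] := boolP (F \in faces Kc r.+2); last by rewrite extend_out.
  rewrite extend_adjoint_boundary // (eq_up dE) up0 //.
  by move: FK; rewrite faces_complement_top => /andP[].
Qed.

(** For a harmonic x of the complement, [down_up_anticomm] reads
    n x = down (up x), with up x supported on the faces of K with r.+2 vertices.
    Hence x itself is supported on K, since n is invertible, and it is an
    eigenvector there. *)
Lemma harmonic_eigenvector : simplicial_complex K -> (0 < #|V|)%N ->
  (exists c : chain R Kc r.+1,
     [/\ c != 0, boundary R oc Kc r c = 0 & adjoint (boundary R oc Kc r.+1) c = 0]) ->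
  passmx.leigenvalue (up_laplacian R o K r) #|V|%:R.
Proof.
move=> cK V_gt0 [d [d0 bd ad]]; pose x := extend oc d.
have n0 : #|V|%:R != 0 :> R by rewrite pnatr_eq0 -lt0n.
have x_card (G : {set V}) : #|G| != r.+1 -> x G = 0.
  by move=> Gr; rewrite /x extend_out // faces_complement_low.
have downx G : down x G = 0.
  have [GK|GK] := boolP (G \in faces Kc r).
    by rewrite -extend_boundary // bd extend0.
  by apply: down_extend_out GK; exact: complement_complex.
have upx F : F \notin faces K r.+2 -> up x F = 0.
  move=> FK; have [Fr|Fr] := eqVneq #|F| r.+2; last exact: up_card Fr.
  have FKc : F \in faces Kc r.+2 by rewrite faces_complement_top Fr eqxx.
  by rewrite -extend_adjoint_boundary // ad extend0.
pose y := restrict o K r.+2 (up x).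
have yE : extend o y =1 up x.
  move=> F; have [FK|FK] := boolP (F \in faces K r.+2); first exact: extend_restrict.
  by rewrite extend_out // upx.
have xE G : #|V|%:R * x G = down (extend o y) G.
  rewrite (eq_down yE) -down_up_anticomm [X in _ + X]big1 ?addr0 // => v _.
  by rewrite downx mulr0.
pose c := restrict o K r.+1 x.
have cE : extend o c =1 x.
  move=> G; have [GK|GK] := boolP (G \in faces K r.+1); first exact: extend_restrict.
  rewrite extend_out //; apply: (mulfI n0); rewrite mulr0 xE.
  by rewrite down_extend_out.
apply/leigenvalueP; exists c; last first.
  apply: contraNneq d0 => c0; apply/eqP/(extend_inj (o := oc)) => G.
  by rewrite extend0 -/x -cE c0 extend0.
have -> : up_laplacian R o K r c = boundary R o K r.+1 y.
  rewrite comp_lfunE; congr (boundary _ _ _ _ _); apply: (extend_inj (o := o)) => F.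
  have [FK|FK] := boolP (F \in faces K r.+2); last by rewrite !extend_out.
  by rewrite extend_adjoint_boundary // (eq_up cE) yE.
apply: (extend_inj (o := o)) => G; rewrite extendZ.
have [GK|GK] := boolP (G \in faces K r.+1); last by rewrite !extend_out ?mulr0.
by rewrite extend_boundary // -xE cE.
Qed.

End Complement.

Theorem theorem3p3 (R : realType) (V : finType) (K : {set {set V}})
    (r n : nat) (oK oKc : orientation V) :
  (1 <= r)%N -> #|V| = n -> simplicial_complex K -> has_dim K r ->
  lambda_max (up_laplacian R oK K r.-1) <= n%:R
  /\ (lambda_max (up_laplacian R oK K r.-1) = n%:R
      <-> exists h : homology R oKc (complement r K) r.-1, h != 0).
Proof.
case: r => // r _ <- cK dimK.
have [eigl lmax] := lambda_max_up_laplacianP R oK cK dimK.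
have le_n := up_laplacian_eigenvalue_le eigl.
split=> //; rewrite homology_neq0P; last exact: complement_complex.
split=> [lE|harm]; first by apply: (eigenvector_harmonic (o := oK)); rewrite -lE.
have V_gt0 : (0 < #|V|)%N.
  have [[F _ cF] _] := dimK; apply: leq_trans (max_card (mem F)).
  by rewrite cF.
apply/le_anti/andP; split=> //.
by apply: lmax; apply: harmonic_eigenvector harm.
Qed.
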